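(* Consider the Gaussian model: $\mu\in\mathbb{R}^d$ is unknown, $\theta_1,\ldots,\theta_m\sim\mathcal{N}(\mu,\sigma_\theta^2 I_d)$ i.i.d., and client $i$ holds $X_{i1},\ldots,X_{in}\sim\mathcal{N}(\theta_i,\sigma_x^2 I_d)$ i.i.d., with $\sigma_\theta\ge 0,\sigma_x>0$ known. Let $\overline{X}_i=\frac{1}{n}\sum_{j=1}^n X_{ij}$. Solving the maximum-likelihood problem $\widehat{\theta}_1,\ldots,\widehat{\theta}_m,\widehat{\mu}=\arg\max_{\theta_1,\ldots,\theta_m,\mu} p(\theta_1,\ldots,\theta_m,X_1,\ldots,X_m\mid\mu)$ yields the closed forms $\widehat{\mu}=\frac{1}{m}\sum_{i=1}^m\overline{X}_i$ and $\widehat{\theta}_i=a\overline{X}_i+(1-a)\widehat{\mu}$ for $i\in[m]$, where $a=\frac{\sigma_\theta^2}{\sigma_\theta^2+\sigma_x^2/n}$. This estimator $\widehat{\theta}_i=a\overline{X}_i+(1-a)\widehat{\mu}$ achieves MSE $\mathbb{E}_{\theta_i,X_1,\ldots,X_m}\|\widehat{\theta}_i-\theta_i\|^2\le\frac{d\sigma_x^2}{n}\left(\frac{1-a}{m}+a\right)$.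
   Context: Personalized estimation setting with $m$ clients, each with $n$ samples, generated by the hierarchical Gaussian model described in the claim.
   Formalization: The maximum-likelihood closed forms are stated for σ_θ > 0 only, since for σ_θ = 0 the law N(μ, 0) has no density and p(θ_1,…,θ_m,X_1,…,X_m | μ) is undefined; the MSE bound is stated for all σ_θ ≥ 0. *)

(* Defs.v *)
From HB Require Import structures.
From mathcomp Require Import all_boot all_order all_algebra.
From mathcomp Require Import all_classical all_reals all_analysis.
Set Implicit Arguments. Unset Strict Implicit. Unset Printing Implicit Defensive.
Import Order.TTheory GRing.Theory Num.Theory.
Local Open Scope classical_set_scope.
Local Open Scope ring_scope.

Definition shrink_a {R : realType} (n : nat) (s_th s_x : R) : R :=
  s_th ^+ 2 / (s_th ^+ 2 + s_x ^+ 2 / n%:R).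

Section gaussian_personalized.
Context {R : realType} {d m n : nat}.

Definition sqnorm (v : 'I_d -> R) : R := \sum_(k < d) v k ^+ 2.

Definition xbar (x : 'I_n -> 'I_d -> R) (k : 'I_d) : R :=
  n%:R^-1 * \sum_(j < n) x j k.

Definition mu_hat (x : 'I_m -> 'I_n -> 'I_d -> R) (k : 'I_d) : R :=
  m%:R^-1 * \sum_(i < m) xbar (x i) k.


Definition theta_hat (s_th s_x : R) (x : 'I_m -> 'I_n -> 'I_d -> R)
  (i : 'I_m) (k : 'I_d) : R :=
  shrink_a n s_th s_x * xbar (x i) k + (1 - shrink_a n s_th s_x) * mu_hat x k.

Definition joint_lik (s_th s_x : R) (th : 'I_m -> 'I_d -> R)
  (x : 'I_m -> 'I_n -> 'I_d -> R) (mu : 'I_d -> R) : R :=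
  (\prod_(i < m) \prod_(k < d) normal_pdf (mu k) s_th (th i k)) *
  (\prod_(i < m) \prod_(j < n) \prod_(k < d) normal_pdf (th i k) s_x (x i j k)).

Definition is_unique_argmax (s_th s_x : R) (x : 'I_m -> 'I_n -> 'I_d -> R)
  (th : 'I_m -> 'I_d -> R) (mu : 'I_d -> R) : Prop :=
  (forall th' mu', joint_lik s_th s_x th' x mu' <= joint_lik s_th s_x th x mu) /\
  (forall th' mu', joint_lik s_th s_x th' x mu' = joint_lik s_th s_x th x mu ->
     th' = th /\ mu' = mu).

End gaussian_personalized.

Section independence.
Context {dT : measure_display} {T : measurableType dT} {R : realType}.

Definition mutually_independent (I : finType) (P : probability T R)
  (Y : I -> T -> R) : Prop :=
  forall (J : {set I}) (B : I -> set R), (forall i, measurable (B i)) ->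
    P [set w | forall i, i \in J -> B i (Y i w)] =
    (\prod_(i | i \in J) P (Y i @^-1` B i))%E.

Definition std_normal (P : probability T R) (Y : T -> R) : Prop :=
  forall A : set R, measurable A -> P (Y @^-1` A) = normal_prob 0 1 A.

End independence.

(* The generative model: with Z_ik, W_ijk i.i.d. N(0,1),
     θ_i = μ + σθ Z_i  ~ N(μ, σθ² I_d)   (i.i.d. over i),
     X_ij = θ_i + σx W_ij ~ N(θ_i, σx² I_d) given θ_i (i.i.d. over j). *)
Definition noise_family {dT : measure_display} {T : measurableType dT}
  {R : realType} {d m n : nat}
  (Z : 'I_m -> 'I_d -> T -> R) (W : 'I_m -> 'I_n -> 'I_d -> T -> R)
  (u : ('I_m * 'I_d) + ('I_m * 'I_n * 'I_d)) : T -> R :=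
  match u with
  | inl (i, k) => Z i k
  | inr (i, j, k) => W i j k
  end.

Definition theta_rv {T : Type} {R : realType} {d m : nat}
  (mu : 'I_d -> R) (s_th : R) (Z : 'I_m -> 'I_d -> T -> R)
  (i : 'I_m) (k : 'I_d) (w : T) : R := mu k + s_th * Z i k w.

Definition X_rv {T : Type} {R : realType} {d m n : nat}
  (mu : 'I_d -> R) (s_th s_x : R) (Z : 'I_m -> 'I_d -> T -> R)
  (W : 'I_m -> 'I_n -> 'I_d -> T -> R)
  (i : 'I_m) (j : 'I_n) (k : 'I_d) (w : T) : R :=
  theta_rv mu s_th Z i k w + s_x * W i j k w.

(* Main.v *)
Require Import Defs.
From HB Require Import structures.
From mathcomp Require Import all_boot all_order all_algebra.
From mathcomp Require Import all_classical all_reals all_analysis.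
From mathcomp Require Import measurable_realfun ring lra.
Import Order.TTheory GRing.Theory Num.Theory.
Import numFieldNormedType.Exports.
Local Open Scope classical_set_scope.
Local Open Scope ring_scope.
Set Implicit Arguments. Unset Strict Implicit. Unset Printing Implicit Defensive.

(* Maximum likelihood: up to a positive constant the joint likelihood is the
   exponential of minus a quadratic form.  Completing squares, first around the
   sample means, then in the [theta_i], then in [mu], writes this form as a
   constant plus positive multiples of the squares of
   [theta_i - (a Xbar_i + (1 - a) mu)] and [mu_hat - mu].

   Mean squared error: each coordinate of the error is the linear combination
   [(1 - a) s_th (Zbar - Z_i) + s_x (a Wbar_i + (1 - a) Wbar)] of the standard
   normal noises.  These have second moment at most 1 and, being independent and
   centered, are pairwise orthogonal in L2, so the mean square of the
   combination is at most the sum of its squared coefficients, which the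
   identity [(1 - a) s_th^2 = a s_x^2 / n] reduces to the announced bound. *)

(** * Sums of squared deviations and products of normal densities *)

Section preliminaries.
Context {R : realType}.
Implicit Types s a : R.

(** Expanding around the mean [c], the cross term drops out because the deviations [y j - c] sum to
    zero. *)
Lemma sum_sqr_deviation (n : nat) (y : 'I_n -> R) a : (0 < n)%N ->
  \sum_(j < n) (y j - a) ^+ 2 =
  \sum_(j < n) (y j - n%:R^-1 * \sum_(l < n) y l) ^+ 2
    + n%:R * (n%:R^-1 * (\sum_(l < n) y l) - a) ^+ 2.
Proof.
move=> n0; set c := n%:R^-1 * _.
have n1 : n%:R != 0 :> R by rewrite pnatr_eq0 -lt0n.
have sumy : \sum_(l < n) y l = n%:R * c by rewrite /c mulVKf.
rewrite (eq_bigr (fun j => (y j - c) ^+ 2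
    + ((c - a) ^+ 2 + 2 * (c - a) * (y j - c)))); last by move=> j _; ring.
rewrite !big_split/=; congr (_ + _).
have -> : \sum_(i < n) 2 * (c - a) * (y i - c) = 0.
  rewrite -mulr_sumr; suff -> : \sum_(i < n) (y i - c) = 0 by rewrite mulr0.
  by rewrite sumrB sumy sumr_const card_ord -(mulr_natl c) subrr.
by rewrite addr0 sumr_const card_ord mulr_natl.
Qed.

Lemma prod_normal_pdf (I : finType) s (c y : I -> R) : s != 0 ->
  \prod_i normal_pdf (c i) s (y i) =
  normal_peak s ^+ #|I| * expR (- ((s ^+ 2 *+ 2)^-1 * \sum_i (y i - c i) ^+ 2)).
Proof.
move=> s0; rewrite mulr_sumr -sumrN expR_sum -prodr_const -big_split/=.
apply: eq_bigr => i _; rewrite normal_pdfE//; congr (_ * expR _).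
by rewrite mulNr mulrC.
Qed.

End preliminaries.

(** * Completing squares in the joint log-likelihood *)

Section joint_maximum_likelihood.
Context {R : realType} {d m n : nat}.
Variables (s t : R) (x : 'I_m -> 'I_n -> 'I_d -> R).
Implicit Types (th : 'I_m -> 'I_d -> R) (mu : 'I_d -> R).

(** Normalising constants are left out, and the coordinate sum is outermost because squares are
    completed one coordinate at a time. *)
Definition neg_log_lik th mu : R :=
  \sum_k ((s ^+ 2 *+ 2)^-1 * \sum_i (th i k - mu k) ^+ 2
    + (t ^+ 2 *+ 2)^-1 * \sum_i \sum_j (x i j k - th i k) ^+ 2).

(* The contribution of coordinate [k] to the excess of [neg_log_lik] over its
   minimum, obtained by completing the square first in [th i k], then in
   [mu k]. *)
Definition excess_coord th mu (k : 'I_d) : R :=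
  ((s ^+ 2 *+ 2)^-1 + n%:R * (t ^+ 2 *+ 2)^-1)
    * \sum_i (th i k - (shrink_a n s t * xbar (x i) k
                         + (1 - shrink_a n s t) * mu k)) ^+ 2
  + shrink_a n s t * (s ^+ 2 *+ 2)^-1 * m%:R * (mu_hat x k - mu k) ^+ 2.

Definition excess th mu : R := \sum_k excess_coord th mu k.

Hypotheses (m0 : (0 < m)%N) (n0 : (0 < n)%N) (s0 : 0 < s) (t0 : 0 < t).

(** The weight [a] is the share of the [n] observations in the total precision on [theta_i], prior
    plus data. *)
Lemma shrink_weight : ((s ^+ 2 *+ 2)^-1 + n%:R * (t ^+ 2 *+ 2)^-1)
  * shrink_a n s t = n%:R * (t ^+ 2 *+ 2)^-1.
Proof.
rewrite /shrink_a; move: n%:R (ltr0n R n) => N; rewrite n0 => N0.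
field.
by rewrite !gt_eqF ?addr_gt0 ?mulr_gt0 ?exprn_gt0.
Qed.

Lemma joint_likE th mu : joint_lik s t th x mu =
  normal_peak s ^+ (m * d) * normal_peak t ^+ (m * (n * d))
    * expR (- neg_log_lik th mu).
Proof.

rewrite /joint_lik pair_bigA/= prod_normal_pdf ?gt_eqF//.
under [X in _ * X = _]eq_bigr do rewrite pair_bigA/=.
rewrite pair_bigA/= (prod_normal_pdf (fun p => th p.1 p.2.2)) ?gt_eqF//.
rewrite !card_prod !card_ord mulrACA -expRD -opprD /neg_log_lik big_split/=.
rewrite -!mulr_sumr.
rewrite (exchange_big _ _ _ _ _ (fun k i => (th i k - mu k) ^+ 2))/=.
rewrite pair_bigA/=.
rewrite (exchange_big _ _ _ _ _
  (fun k i => \sum_j (x i j k - th i k) ^+ 2))/=.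
under [X in _ = _ * expR (- (_ + _ * X))]eq_bigr do
  rewrite exchange_big/= pair_bigA/=.
by rewrite pair_bigA.
Qed.

Lemma neg_log_lik_excess : exists K, forall th mu,
  neg_log_lik th mu = K + excess th mu.
Proof.
set A := (s ^+ 2 *+ 2)^-1; set B := (t ^+ 2 *+ 2)^-1; set a := shrink_a n s t.
(* The constant gathers what no parameter affects: the scatter within clients and, scaled by
   [a * A], the scatter of the sample means. *)
exists (\sum_k (B * \sum_i \sum_j (x i j k - xbar (x i) k) ^+ 2
   + a * A * \sum_i (xbar (x i) k - mu_hat x k) ^+ 2)) => th mu.
rewrite /neg_log_lik /excess -big_split/=; apply: eq_bigr => k _.
rewrite /excess_coord.
have -> : \sum_i \sum_j (x i j k - th i k) ^+ 2 =
    \sum_i \sum_j (x i j k - xbar (x i) k) ^+ 2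
    + \sum_i n%:R * (xbar (x i) k - th i k) ^+ 2.
  by rewrite -big_split/=; apply: eq_bigr => i _; exact: sum_sqr_deviation.
have := sum_sqr_deviation (fun i => xbar (x i) k) (mu k) m0.
rewrite -/(mu_hat x k) => /(congr1 (fun z => a * A * z)).
rewrite mulrDr mulrA => E.
rewrite addrACA -E mulrDr addrCA -!addrA; congr (_ + _).
rewrite -/A -/B -/a !mulr_sumr -!big_split/=; apply: eq_bigr => i _.
set y := xbar _ _; set z := mu k; set h := th i k.
(* With [S] the total precision, the two weights become [S (1 - a)] and [S a]; up to the factor [S],
   what remains is [(1 - a) (h - z)^2 + a (y - h)^2 = (h - (a y + (1 - a) z))^2 + a (1 - a) (y -
   z)^2]. *)
have eA : A = (A + n%:R * B) * (1 - a).
  by rewrite mulrBr mulr1 shrink_weight addrK.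
have eB : n%:R * B = (A + n%:R * B) * a by rewrite shrink_weight.
move: (A + n%:R * B) eA eB => S eA eB.
have -> : B * (n%:R * (y - h) ^+ 2) = (n%:R * B) * (y - h) ^+ 2 by ring.
by rewrite eB eA; ring.
Qed.

Lemma shrink_a_gt0 : 0 < shrink_a n s t.
Proof.
by rewrite divr_gt0 ?addr_gt0 ?divr_gt0 ?exprn_gt0 ?ltr0n.
Qed.

Let half_precision_gt0 (r : R) : 0 < r -> 0 < (r ^+ 2 *+ 2)^-1.
Proof. by move=> r0; rewrite invr_gt0 mulr2n addr_gt0 ?exprn_gt0. Qed.

Let weight_th_gt0 : 0 < (s ^+ 2 *+ 2)^-1 + n%:R * (t ^+ 2 *+ 2)^-1.
Proof.
by rewrite addr_gt0 ?mulr_gt0 ?half_precision_gt0 ?ltr0n.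
Qed.

Let weight_mu_gt0 : 0 < shrink_a n s t * (s ^+ 2 *+ 2)^-1 * m%:R.
Proof.
apply: mulr_gt0; last by rewrite ltr0n.
by apply: mulr_gt0; [exact: shrink_a_gt0|exact: half_precision_gt0].
Qed.

Lemma excess_coord_ge0 th mu k : 0 <= excess_coord th mu k.
Proof.
apply: addr_ge0; apply: mulr_ge0; rewrite ?sqr_ge0//; try exact: ltW.
by apply: sumr_ge0 => i _; exact: sqr_ge0.
Qed.

Lemma excess_ge0 th mu : 0 <= excess th mu.
Proof. by apply: sumr_ge0 => k _; exact: excess_coord_ge0. Qed.

Lemma excess_hat : excess (theta_hat s t x) (mu_hat x) = 0.
Proof.
apply: big1 => k _; rewrite /excess_coord subrr expr0n mulr0 addr0 big1 ?mulr0// => i _.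
by rewrite /theta_hat subrr expr0n.
Qed.

Lemma excess_eq0 th mu : excess th mu = 0 ->
  th = theta_hat s t x /\ mu = mu_hat x.
Proof.
move=> /eqP; rewrite psumr_eq0; last by move=> k _; exact: excess_coord_ge0.
move=> /allP e0.
have {}e0 k : (forall i, th i k = shrink_a n s t * xbar (x i) k
    + (1 - shrink_a n s t) * mu k) /\ mu k = mu_hat x k.
  have := e0 k; rewrite mem_index_enum => /(_ isT)/=.
  rewrite /excess_coord paddr_eq0; last 2 first.
  - apply: mulr_ge0; first exact: ltW.
    by apply: sumr_ge0 => i _; exact: sqr_ge0.
  - by apply: mulr_ge0; [exact: ltW|exact: sqr_ge0].
  rewrite !mulf_eq0 (gt_eqF weight_th_gt0)/=.
  (* The factors of the second weight are regrouped, since [weight_mu_gt0] gives positivity of the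
     whole product. *)
  rewrite -!mulf_eq0 mulf_eq0 (gt_eqF weight_mu_gt0)/= sqrf_eq0 subr_eq0.
  move=> /andP[th0 /eqP muE]; split=> // i.
  move: th0; rewrite psumr_eq0; last by move=> *; exact: sqr_ge0.
  by move=> /allP/(_ i (mem_index_enum _)); rewrite /= sqrf_eq0 subr_eq0 => /eqP.
split; last by apply/funext => k; have [] := e0 k.
by apply/funext => i; apply/funext => k; have [-> ->] := e0 k.
Qed.

Lemma map_unique_argmax : is_unique_argmax s t x (theta_hat s t x) (mu_hat x).
Proof.
have [K KE] := neg_log_lik_excess.
have C0 : 0 < normal_peak s ^+ (m * d) * normal_peak t ^+ (m * (n * d)).
  by rewrite mulr_gt0// exprn_gt0// normal_peak_gt0// gt_eqF.
split=> th mu; rewrite !joint_likE !KE excess_hat addr0.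
  by rewrite ler_pM2l// ler_expR lerN2 lerDl excess_ge0.
move=> /(mulfI (lt0r_neq0 C0))/expR_inj/oppr_inj/eqP.
by rewrite -subr_eq0 addrC addKr => /eqP; exact: excess_eq0.
Qed.

End joint_maximum_likelihood.

(** * Integration against the normal law and its first two moments *)

Section normal_integral.
Context {R : realType}.
Notation mu := (@lebesgue_measure R).
Local Open Scope ereal_scope.

(** The Radon-Nikodym derivative of [normal_prob] agrees almost everywhere with [normal_pdf], since
    both have the same integral over every measurable set. *)
Lemma ge0_integral_normal_prob (m s : R) (f : R -> \bar R) :
  (forall x, 0 <= f x) -> measurable_fun [set: R] f ->
  \int[normal_prob m s]_x f x = \int[mu]_x (f x * (normal_pdf m s x)%:E).
Proof.
move=> f0 mf; have dom := normal_prob_dominates m s.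
rewrite -(Radon_Nikodym_SigmaFinite.change_of_variables dom)//.
have mpdf : measurable_fun [set: R] (fun x => (normal_pdf m s x)%:E).
  by apply/measurable_EFinP; exact: measurable_normal_pdf.
have irn := Radon_Nikodym_SigmaFinite.f_integrable dom.
apply: ae_eq_integral => //.
- by apply: emeasurable_funM => //; exact: measurable_int irn.
- exact: emeasurable_funM.
apply: ae_eqe_mul2l; apply: integral_ae_eq => //= E _ mE.
by rewrite -Radon_Nikodym_SigmaFinite.f_integral.
Qed.

Let phi : R -> R := normal_pdf 0 1.

Let continuous_phi : continuous phi.
Proof. exact: continuous_normal_pdf. Qed.

Let phiE x : phi x = (normal_peak 1 * expR (- (x ^+ 2 / 2)))%R.
Proof.
rewrite /phi normal_pdfE ?oner_neq0// /normal_fun subr0 expr1n.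
by rewrite mulNr.
Qed.

Let is_derive_phi (x : R) : is_derive x 1%R phi (- (x * phi x))%R.
Proof.
rewrite [X in is_derive _ _ X _](_ : phi =
    normal_peak 1 \*: (expR \o (- (2^-1 \*: (@id R ^+ 2)))))%R; last first.
  by apply/funext => y; rewrite phiE/= !fctE (mulrC (_ ^+ 2)%R).
apply: is_derive_eq; rewrite phiE /GRing.scale/= !fctE/= /GRing.scale/=.
rewrite (mulrC 2^-1%R (_ ^+ 2)%R) expr1 mulr1 mulKf//; ring.
Qed.

Let phi_ge0 x : (0 <= phi x)%R. Proof. exact: normal_pdf_ge0. Qed.


(* Since [(x phi x)' = phi x - x^2 phi x], the second moment truncated to [0, b]
   is the mass of [0, b] minus [b phi b]. *)
Lemma integral_sqr_normal_prob01_le1 :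
  \int[normal_prob 0 1]_(x in [set: R]) (x ^+ 2)%:E <= 1.
Proof.
rewrite ge0_integral_normal_prob//; last 2 first.
  by move=> x; rewrite lee_fin sqr_ge0.
  by apply/measurable_EFinP; exact: measurable_funX.
have cx2phi : continuous (fun x : R => x ^+ 2 * phi x)%R.
  by move=> x; apply: cvgM; [exact: exprn_continuous|exact: continuous_phi].
have ephi x : phi (- x)%R = phi x by rewrite !phiE sqrrN.
have x2phi0 x : (0 <= x ^+ 2 * phi x)%R by rewrite mulr_ge0 ?sqr_ge0.
under eq_integral do rewrite -EFinM.
(* The bound 1 is turned into the total mass of [phi], so that evenness reduces both sides to twice
   a half-line integral. *)
rewrite -(integral_normal_pdf 0 1) -/phi.
rewrite (@ge0_symfun_integralT _ (fun x => x ^+ 2 * phi x)%R)//; last first.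
  by move=> x /=; rewrite ephi sqrrN.
rewrite (@ge0_symfun_integralT _ phi)//; last by move=> x /=; rewrite ephi.
rewrite lee_pmul2l// -set_itvcy.
have mphi : measurable_fun [set: R] phi by exact: measurable_normal_pdf.
have mx2phi := continuous_measurable_fun cx2phi.
(* The half-line integral is the limit of the integrals over [[0, n]], so a bound for each [n]
   suffices. *)
have cvg2 := @ge0_cvgn_integral R mu _ x2phi0 mx2phi.
rewrite -(cvg_lim _ cvg2)//; apply: lime_le.
  by apply/cvg_ex; eexists; exact: cvg2.
apply: nearW => n.
apply: (@le_trans _ _ (\int[mu]_(x in `[0%R, n%:R]) (phi x)%:E)); last first.
  apply: ge0_subset_integral => //.
  - exact/measurable_funTS/measurable_EFinP.
  - by move=> x _; rewrite lee_fin.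
  - by move=> x /=; rewrite !in_itv/= => /andP[->].
(* The interval [[0, 0]] is set apart because the fundamental theorem of calculus is applied with
   [0 < b]. *)
case: n => [|n].
  by rewrite set_itv1 !integral_set1.
have n0 : (0 < n.+1%:R :> R)%R by rewrite ltr0n.
move: n.+1%:R%R n0 => b b0.
have cint (f : R -> R) : continuous f -> mu.-integrable `[0%R, b] (EFin \o f).
  move=> cf; apply: continuous_compact_integrable; first exact: segment_compact.
  exact: continuous_subspaceT.
rewrite -sube_ge0; last first.
  by rewrite (integrable_fin_num _ (cint _ cx2phi)).
rewrite -integralB//=; [|exact: cint|exact: cint].
have dG (x : R) : is_derive x 1%R (fun y => y * phi y)%R (phi x - x ^+ 2 * phi x)%R.
  apply: (is_derive_eq (is_deriveM (is_derive_id x 1%R) (is_derive_phi x))).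
  by rewrite /GRing.scale/=; ring.
rewrite (@continuous_FTC2 _ (fun x => phi x - x ^+ 2 * phi x)%R
   (fun x => x * phi x)%R _ _ b0)//.
- by rewrite mul0r sube0 lee_fin mulr_ge0// ltW.
- apply: continuous_subspaceT => x; apply: cvgB; [exact: continuous_phi|exact: cx2phi].
- have cG : continuous (fun x : R => x * phi x)%R.
    by move=> x; apply: cvgM; [exact: cvg_id|exact: continuous_phi].
  split; [|exact/cvg_at_right_filter/cG|exact/cvg_at_left_filter/cG].
  by move=> x _; have [] := dG x.
- by move=> x _; rewrite derive1E; have [_ ->] := dG x.
Qed.

(** After splitting at 0 and substituting on the negative half-line, the reflection merely swaps the
    two halves. *)
Lemma ge0_integralT_oppr (g : R -> R) : (forall x, (0 <= g x)%R) ->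
  continuous g -> \int[mu]_x (g x)%:E = \int[mu]_x (g (- x)%R)%:E.
Proof.
have split_half (h : R -> R) : (forall x, (0 <= h x)%R) -> continuous h ->
    \int[mu]_x (h x)%:E = \int[mu]_(x in `[0%R, +oo[) (h x)%:E
      + \int[mu]_(x in `[0%R, +oo[) (h (- x)%R)%:E.
  move=> h0 ch.
  have mh : measurable_fun [set: R] h by exact: continuous_measurable_fun.
  rewrite -(setUv `[0%R, +oo[%classic) ge0_integral_setU//=; last 4 first.
  - exact: measurableC.
  - by apply/measurable_EFinP; rewrite setUv.
  - by move=> x _; rewrite lee_fin.
  - exact/disj_setPCl.
  congr (_ + _); rewrite setCitvr.
  rewrite integral_itv_bndo_bndc; last exact/measurable_EFinP/measurable_funTS.
  rewrite -{1}oppr0 ge0_integration_by_substitutionNy//.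
  exact: continuous_subspaceT.
move=> g0 cg; rewrite split_half// [RHS]split_half//; last first.
  by move=> x; apply: continuous_comp; [exact: opp_continuous|exact: cg].
by rewrite addeC; congr (_ + _); apply: eq_integral => x _; rewrite opprK.
Qed.

Lemma integrable_sqr_normal_prob01 :
  (normal_prob 0 1).-integrable [set: R] (fun x => (x ^+ 2)%:E).
Proof.
apply/integrableP; split.
  by apply/measurable_EFinP; exact: measurable_funX.
under eq_integral do rewrite gee0_abs ?lee_fin ?sqr_ge0//.
exact: le_lt_trans integral_sqr_normal_prob01_le1 (ltry _).
Qed.

(** Domination: [|x| <= 1 + x^2]. *)
Lemma integrable_id_normal_prob01 :
  (normal_prob 0 1).-integrable [set: R] EFin.
Proof.
have i1 : (normal_prob 0 1).-integrable [set: R] (cst 1%E).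
  exact: finite_measure_integrable_cst.
apply: le_integrable (integrableD measurableT i1 integrable_sqr_normal_prob01) => //.
move=> x _ /=; rewrite lee_fin.
rewrite (ger0_norm (addr_ge0 ler01 (sqr_ge0 _))) -(real_normK (num_real x)).
by move: `|x|%R (normr_ge0 x) => a; nra.
Qed.

(** The reflection lemma takes nonnegative integrands, so it is applied to [|x| + x]. The integral
    of [|x|] is finite, hence cancels, leaving the mean equal to its opposite. *)
Lemma integral_id_normal_prob01 : \int[normal_prob 0 1]_(x in [set: R]) x%:E = 0.
Proof.
have ix := integrable_id_normal_prob01.
have ia := integrable_abse ix.
have e : \int[normal_prob 0 1]_(x in [set: R]) (`|x| + x)%:E =
    \int[normal_prob 0 1]_(x in [set: R]) (`|x| - x)%:E.
  (* [x |-> -x] preserves [phi] and exchanges [|x| + x] and [|x| - x]. *)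
  have h1 x : (0 <= `|x| + x :> R)%R by rewrite -lerBlDr sub0r -normrN ler_norm.
  have h2 x : (0 <= `|x| - x :> R)%R by rewrite subr_ge0 ler_norm.
  have ca : continuous (fun x : R => `|x| + x)%R.
    by move=> x; apply: cvgD; [exact: norm_continuous|exact: cvg_id].
  rewrite ge0_integral_normal_prob; last 2 first.
  - by move=> x; rewrite lee_fin.
  - by apply/measurable_EFinP; exact: (continuous_measurable_fun ca).
  rewrite [RHS]ge0_integral_normal_prob; last 2 first.
  - by move=> x; rewrite lee_fin.
  - by apply/measurable_EFinP; apply: measurable_funB => //; exact: measurable_normr.
  under eq_integral do rewrite -EFinM.
  under [RHS]eq_integral do rewrite -EFinM.
  rewrite (@ge0_integralT_oppr (fun x => (`|x| + x) * phi x)%R).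
  - apply: eq_integral => x _; rewrite normrN; congr (_ * _)%:E.
    by rewrite /phi -/(phi _) -/(phi _) !phiE sqrrN.
  - by move=> x; rewrite mulr_ge0.
  - by move=> x; apply: cvgM; [exact: ca|exact: continuous_phi].
have eD := integralD measurableT ia ix.
have eB := integralB measurableT ia ix.
have {eD eB}e : \int[normal_prob 0 1]_(x in [set: R]) `|x%:E|
    + \int[normal_prob 0 1]_(x in [set: R]) x%:E =
    \int[normal_prob 0 1]_(x in [set: R]) `|x%:E|
    - \int[normal_prob 0 1]_(x in [set: R]) x%:E by rewrite -eD -eB.
move: e.
rewrite -(fineK (integrable_fin_num measurableT ix)).
rewrite -(fineK (integrable_fin_num measurableT ia))/=.
move: (fine _) (fine _) => a b.
by rewrite -EFinD -EFinB => -[] ab; congr EFin; lra.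
Qed.

End normal_integral.

(** * Products of independent variables and combinations of orthogonal ones *)

Section independent_product.
Context {dT : measure_display} {T : measurableType dT} {R : realType}.
Variable P : probability T R.
Local Open Scope ereal_scope.

(** Once the joint law is the product law, Fubini integrates over the second variable first, with
    the first pulled out as a constant. *)
Lemma integral_indepM (X Y : {RV P >-> R}) :
  (forall A B, measurable A -> measurable B ->
     P ((X @^-1` A) `&` (Y @^-1` B)) = P (X @^-1` A) * P (Y @^-1` B)) ->
  P.-integrable setT (EFin \o X) -> P.-integrable setT (EFin \o Y) ->
  P.-integrable setT (fun w => (X w * Y w)%:E) ->
  \int[P]_w (X w * Y w)%:E = (\int[P]_w (X w)%:E) * (\int[P]_w (Y w)%:E).
Proof.
move=> indep iX iY iXY.
pose XY (w : T) : R * R := (X w, Y w).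
have mXY : measurable_fun [set: T] XY by exact/measurable_fun_pair.
pose g (z : R * R) : \bar R := (z.1 * z.2)%:E.
have mg : measurable_fun [set: R * R] g.
  by apply/measurable_EFinP; apply: measurable_funM.
pose PX := distribution P X; pose PY := distribution P Y.
(* Independence on rectangles identifies the joint law with the product law. *)
have prodE A : measurable A -> (PX \x PY) A = pushforward P XY A.
  move=> mA.
  exact: (@product_measure_unique _ _ _ _ _ PX PY (pushforward P XY)).
have ig : (PX \x PY).-integrable setT g.
  have /integrableP[_ gfin] : (pushforward P XY).-integrable setT g.
    exact: integrable_pushforward.
  apply/integrableP; split => //.
  by rewrite (eq_measure_integral (pushforward P XY)) => [|A mA _]; last exact: prodE.
transitivity (\int[pushforward P XY]_z g z); first by rewrite integral_pushforward.
rewrite (eq_measure_integral (PX \x PY)%E)/=; last by move=> A mA _; rewrite prodE.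
rewrite -integral12_prod_meas1//=.
rewrite -(integral_distribution (X := X) (f := EFin))// -/PX.
rewrite -(integral_distribution (X := Y) (f := EFin))// -/PY.
have iPX : PX.-integrable setT EFin by exact: integrable_pushforward.
have iPY : PY.-integrable setT EFin by exact: integrable_pushforward.
rewrite -[in RHS](fineK (integrable_fin_num measurableT iPY)) -integralZr//.
apply: eq_integral => x _; rewrite /fubini_F /g/=.
under eq_integral do rewrite EFinM.
by rewrite integralZl// fineK// integrable_fin_num.
Qed.

Lemma integrable_sqr (X : {RV P >-> R}) :
  \int[P]_w (X w ^+ 2)%:E < +oo -> P.-integrable setT (fun w => (X w ^+ 2)%:E).
Proof.
move=> X2; apply/integrableP; split.
  by apply/measurable_EFinP; apply: measurable_funX.
by under eq_integral do rewrite gee0_abs ?lee_fin ?sqr_ge0//.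
Qed.

(** Domination: [|x y| <= x^2 + y^2]. *)
Lemma integrableM_of_sqr (X Y : {RV P >-> R}) :
  P.-integrable setT (fun w => (X w ^+ 2)%:E) ->
  P.-integrable setT (fun w => (Y w ^+ 2)%:E) ->
  P.-integrable setT (fun w => (X w * Y w)%:E).
Proof.
move=> iX iY; apply: (le_integrable _ _ _ (integrableD measurableT iX iY)) => //.
  by apply/measurable_EFinP; apply: measurable_funM.
move=> w _; rewrite -EFinD !abse_EFin lee_fin normrM.
rewrite (ger0_norm (addr_ge0 (sqr_ge0 _) (sqr_ge0 _))).
rewrite -(real_normK (num_real (X w))) -(real_normK (num_real (Y w))).
have := normr_ge0 (X w); have := normr_ge0 (Y w).
by move: `|X w|%R `|Y w|%R => a b; nra.
Qed.

(** The square expands into a sum over pairs: off-diagonal pairs integrate to zero, diagonal ones to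
    at most [c u ^+ 2]. An upper bound on the second moments is thus all that the normal law has to
    supply. *)
Lemma integral_sqr_lin_comb_le (I : finType) (Y : I -> {RV P >-> R}) (c : I -> R) :
  (forall u, \int[P]_w (Y u w ^+ 2)%:E <= 1) ->
  (forall u v, u != v -> \int[P]_w (Y u w * Y v w)%:E = 0) ->
  \int[P]_w ((\sum_u c u * Y u w) ^+ 2)%:E <= (\sum_u c u ^+ 2)%:E.
Proof.
move=> Y2 YY.
have iYY u v : P.-integrable setT (fun w => (Y u w * Y v w)%:E).
  by apply: integrableM_of_sqr; apply: integrable_sqr;
    exact: le_lt_trans (Y2 _) (ltry _).
have -> : \int[P]_w ((\sum_u c u * Y u w) ^+ 2)%:E =
    \int[P]_w \sum_(p : I * I) ((c p.1 * c p.2)%:E * (Y p.1 w * Y p.2 w)%:E).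
  apply: eq_integral => w _; rewrite sumEFin; congr EFin.
  rewrite expr2 big_distrlr/= pair_bigA/=; apply: eq_bigr => p _; ring.
rewrite integral_sum//; last by move=> p; exact: integrableZl.
under eq_bigr do rewrite integralZl//.
rewrite -(pair_bigA _ (fun u v => (c u * c v)%:E * \int[P]_w (Y u w * Y v w)%:E))/=.
rewrite -sumEFin; apply: lee_sum => u _.
rewrite (bigD1 u)//= big1 ?adde0; last first.
  by move=> v vu; rewrite YY ?mule0// eq_sym.
rewrite -[leRHS]mule1 -expr2; apply: lee_wpmul2l; first by rewrite lee_fin sqr_ge0.
exact: Y2.
Qed.

End independent_product.

(** * Moments and orthogonality of standard normal random variables *)

Section standard_normal_rv.
Context {dT : measure_display} {T : measurableType dT} {R : realType}.
Variable P : probability T R.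
Local Open Scope ereal_scope.

(* [normal_prob] lives on [measurableTypeR R], whose sigma-algebra is the Borel
   one of [R] but whose display differs. *)
Lemma measurable_RV_measurableTypeR (Y : {RV P >-> R}) :
  measurable_fun [set: T] (Y : T -> measurableTypeR R).
Proof. by move=> _ A mA; rewrite setTI; have := measurable_funPTI Y mA. Qed.

Lemma ge0_integral_std_normal (Y : {RV P >-> R}) (f : R -> \bar R) :
  std_normal P Y -> (forall y, 0 <= f y) -> measurable_fun [set: R] f ->
  \int[P]_w f (Y w) = \int[normal_prob 0 1]_(y in [set: R]) f y.
Proof.
move=> nY f0 mf; have mY := measurable_RV_measurableTypeR Y.
transitivity (\int[pushforward P (Y : T -> measurableTypeR R)]_y f y).
  by rewrite ge0_integral_pushforward.
by apply: eq_measure_integral => A mA _; exact: nY.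
Qed.

Lemma integral_sqr_std_normal_le1 (Y : {RV P >-> R}) :
  std_normal P Y -> \int[P]_w (Y w ^+ 2)%:E <= 1.
Proof.
move=> nY; apply: le_trans (@integral_sqr_normal_prob01_le1 R).
rewrite (ge0_integral_std_normal (f := fun y => (y ^+ 2)%:E) nY)//.
  by move=> y; rewrite lee_fin sqr_ge0.
by apply/measurable_EFinP; exact: measurable_funX.
Qed.

Lemma integrable_std_normal (Y : {RV P >-> R}) :
  std_normal P Y -> P.-integrable setT (EFin \o Y).
Proof.
move=> nY; have /integrableP[_ fin] := @integrable_id_normal_prob01 R.
apply/integrableP; split; first exact/measurable_EFinP.
apply: le_lt_trans fin.
rewrite (ge0_integral_std_normal (f := fun y => `|y%:E|) nY)//.
exact: measurableT_comp.
Qed.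

Lemma integral_std_normal (Y : {RV P >-> R}) :
  std_normal P Y -> \int[P]_w (Y w)%:E = 0.
Proof.
move=> nY; rewrite -(@integral_id_normal_prob01 R).
have mY := measurable_RV_measurableTypeR Y.
transitivity (\int[pushforward P (Y : T -> measurableTypeR R)]_y y%:E).
  by rewrite integral_pushforward//; exact: integrable_std_normal.
by apply: eq_measure_integral => A mA _; exact: nY.
Qed.

Lemma mutually_independent_pair (I : finType) (Y : I -> T -> R) (u v : I)
    (A B : set R) :
  mutually_independent P Y -> u != v -> measurable A -> measurable B ->
  P ((Y u @^-1` A) `&` (Y v @^-1` B)) = P (Y u @^-1` A) * P (Y v @^-1` B).
Proof.
move=> indep uv mA mB.
(* Independence asks for a measurable set at every index; [B] fills the indices outside the pair,
   which impose no constraint. *)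
have := indep [set u; v]%SET (fun i => if i == u then A else B).
rewrite big_setU1 ?inE//= big_set1 eqxx eq_sym (negbTE uv) => <-; last first.
  by move=> i; case: ifP.
congr (P _); apply/seteqP; split => w /=.
  move=> [Au Bv] i; rewrite !inE => /orP[] /eqP ->; first by rewrite eqxx.
  by rewrite eq_sym (negbTE uv).
move=> h; split.
  by have := h u; rewrite !inE eqxx; exact.
by have := h v; rewrite !inE eqxx orbT eq_sym (negbTE uv); exact.
Qed.

(** Independence factors the integral into vanishing means; the second moments make the product
    integrable. *)
Lemma integral_std_normalM (X Y : {RV P >-> R}) :
  std_normal P X -> std_normal P Y ->
  (forall A B, measurable A -> measurable B ->
     P ((X @^-1` A) `&` (Y @^-1` B)) = P (X @^-1` A) * P (Y @^-1` B)) ->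
  \int[P]_w (X w * Y w)%:E = 0.
Proof.
move=> nX nY XY; rewrite integral_indepM//.
- by rewrite (integral_std_normal nX) mul0e.
- exact: integrable_std_normal.
- exact: integrable_std_normal.
- by apply: integrableM_of_sqr; apply: integrable_sqr;
    apply: le_lt_trans (integral_sqr_std_normal_le1 _) (ltry _).
Qed.

End standard_normal_rv.

(** * The estimation error as a linear combination of noises *)

Section error_decomposition.
Context {R : realType} {d m n : nat}.
Variables (s t : R) (i : 'I_m).
Hypotheses (m0 : (0 < m)%N) (n0 : (0 < n)%N).
Local Notation a := (shrink_a n s t).

(** The client noises sit under [inl], the observation noises under [inr]. No coordinate index
    occurs, as the coefficients are the same in every coordinate. *)
Definition error_coef (u : 'I_m + 'I_m * 'I_n) : R :=
  match u with
  | inl i' => s * (1 - a) * (m%:R^-1 - (i' == i)%:R)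
  | inr p => t / n%:R * (a * (p.1 == i)%:R + (1 - a) / m%:R)
  end.

Let sum_delta (f : 'I_m -> R) : \sum_i' (i' == i)%:R * f i' = f i.
Proof.
rewrite (bigD1 i)//= eqxx mul1r big1 ?addr0// => j /negbTE ->.
by rewrite mul0r.
Qed.

Let m1 : m%:R != 0 :> R. Proof. by rewrite pnatr_eq0 -lt0n. Qed.
Let n1 : n%:R != 0 :> R. Proof. by rewrite pnatr_eq0 -lt0n. Qed.

(** The unknown [mu k] cancels because the weights [a] and [1 - a] sum to 1. *)
Lemma error_lin_comb (mu : 'I_d -> R) (k : 'I_d) (z : 'I_m -> 'I_d -> R)
    (w : 'I_m -> 'I_n -> 'I_d -> R) :
  theta_hat s t (fun i' j k' => mu k' + s * z i' k' + t * w i' j k') i k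
    - (mu k + s * z i k) =
  \sum_u error_coef u *
    match u with inl i' => z i' k | inr p => w p.1 p.2 k end.
Proof.
have xbarE i' : xbar (fun j k' => mu k' + s * z i' k' + t * w i' j k') k =
    mu k + s * z i' k + t / n%:R * \sum_j w i' j k.
  rewrite /xbar big_split/= sumr_const card_ord -mulr_sumr mulrDr.
  by rewrite -(mulr_natl (_ + _)) mulKf// mulrA [n%:R^-1 * t]mulrC.
rewrite /theta_hat /mu_hat xbarE (eq_bigr _ (fun i' _ => xbarE i')).
rewrite big_sumType/= !big_split/= sumr_const card_ord -!mulr_sumr.
set Zs := \sum_i' z i' k; set Ws := \sum_i' \sum_j w i' j k.
have -> : \sum_i' s * (1 - a) * (m%:R^-1 - (i' == i)%:R) * z i' k =
    s * (1 - a) * (m%:R^-1 * Zs - z i k).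
  rewrite -[in RHS](sum_delta (z^~ k)) mulr_sumr -sumrB mulr_sumr.
  by apply: eq_bigr => i' _; ring.
have -> : \sum_(p : 'I_m * 'I_n) 
     t / n%:R * (a * (p.1 == i)%:R + (1 - a) / m%:R) * w p.1 p.2 k =
    t / n%:R * (a * (\sum_j w i j k) + (1 - a) / m%:R * Ws).
  rewrite -[in RHS](sum_delta (fun i' => \sum_j w i' j k)).
  rewrite !mulr_sumr -big_split/= mulr_sumr.
  rewrite -(pair_bigA _ (fun i' j =>
    t / n%:R * (a * (i' == i)%:R + (1 - a) / m%:R) * w i' j k))/=.
  by apply: eq_bigr => i' _; rewrite -mulr_sumr; ring.
rewrite -(mulr_natl (mu k)).
move: (\sum_j w i j k) (z i k) (mu k) Zs Ws a => W0 z0 mu0 Zs Ws a.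
by field; rewrite m1 n1.
Qed.

Lemma sum_sqr_error_coef : 0 < t -> \sum_u error_coef u ^+ 2 =
  t ^+ 2 / n%:R * ((1 - a) / m%:R + a).
Proof.
move=> t0; rewrite big_sumType/=.
have -> : \sum_i' (s * (1 - a) * (m%:R^-1 - (i' == i)%:R)) ^+ 2 =
   s ^+ 2 * (1 - a) ^+ 2 * (1 - m%:R^-1).
  (* The summand is the square of [m^-1 - delta], expanded with [delta^2 = delta] for the indicator
     [delta] of [i' = i]. *)
  have -> : 1 - m%:R^-1 =
      \sum_i' (m%:R^-1 ^+ 2 + (i' == i)%:R * (1 - 2 * m%:R^-1)) :> R.
    rewrite big_split/= sum_delta sumr_const card_ord -(mulr_natl (_ ^+ 2)).
    by field; rewrite m1.
  rewrite mulr_sumr; apply: eq_bigr => i' _.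
  by case: (i' == i) => /=; ring.
have -> : \sum_(p : 'I_m * 'I_n) 
     (t / n%:R * (a * (p.1 == i)%:R + (1 - a) / m%:R)) ^+ 2 =
    t ^+ 2 / n%:R * (a ^+ 2 + 2 * a * ((1 - a) / m%:R) + m%:R * ((1 - a) / m%:R) ^+ 2).
  rewrite -(pair_bigA _ (fun i' j =>
    (t / n%:R * (a * (i' == i)%:R + (1 - a) / m%:R)) ^+ 2))/=.
  have -> : a ^+ 2 + 2 * a * ((1 - a) / m%:R) + m%:R * ((1 - a) / m%:R) ^+ 2 =
      \sum_i' (((1 - a) / m%:R) ^+ 2
        + (i' == i)%:R * (a ^+ 2 + 2 * a * ((1 - a) / m%:R))).
    by rewrite big_split/= sum_delta sumr_const card_ord -(mulr_natl (_ ^+ 2)) addrC.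
  rewrite mulr_sumr; apply: eq_bigr => i' _.
  rewrite sumr_const card_ord -(mulr_natl (_ ^+ 2)).
  by move: a => a'; case: (i' == i) => /=; field; rewrite m1 n1.
(* This trades the client variance for the sampling variance. It covers [s = 0] too, since [0 < t]
   keeps the denominator positive. *)
have sa : s ^+ 2 * (1 - a) = a * (t ^+ 2 / n%:R).
  have D0 : s ^+ 2 * n%:R + t ^+ 2 != 0.
    by rewrite gt_eqF// ltr_wpDl ?exprn_gt0// mulr_ge0 ?sqr_ge0.
  by rewrite /shrink_a; field; rewrite n1.
rewrite [(1 - a) ^+ 2]expr2 mulrA sa; move: a => a'.
by field; rewrite m1 n1.
Qed.

End error_decomposition.

Theorem theorem1 (R : realType) (d m n : nat) (s_th s_x : R) :
  (0 < m)%N -> (0 < n)%N -> 0 <= s_th -> 0 < s_x ->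
  (* (1) maximum likelihood: closed forms (density exists when σθ > 0) *)
  (0 < s_th -> forall x : 'I_m -> 'I_n -> 'I_d -> R,
     is_unique_argmax s_th s_x x (theta_hat s_th s_x x) (mu_hat x)) /\
  (* (2) MSE of θ̂_i under the hierarchical Gaussian model *)
  (forall (mu : 'I_d -> R) (dT : measure_display) (T : measurableType dT)
          (P : probability T R)
          (Z : 'I_m -> 'I_d -> {RV P >-> R})
          (W : 'I_m -> 'I_n -> 'I_d -> {RV P >-> R}),
     (forall i k, std_normal P (Z i k)) ->
     (forall i j k, std_normal P (W i j k)) ->
     mutually_independent P
       (noise_family (fun i k => (Z i k : T -> R)) (fun i j k => (W i j k : T -> R))) ->
     forall i : 'I_m,
       ('E_P[(fun w =>
           sqnorm (fun k =>
             theta_hat s_th s_x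
               (fun i' j k' => X_rv mu s_th s_x (fun a b => Z a b : T -> R)
                                 (fun a b c => W a b c : T -> R) i' j k' w) i k
             - theta_rv mu s_th (fun a b => Z a b : T -> R) i k w))%R]
        <= (d%:R * s_x ^+ 2 / n%:R * ((1 - shrink_a n s_th s_x) / m%:R
                                      + shrink_a n s_th s_x))%:E)%E).
Proof.
move=> m0 n0 s0 t0; split; first by move=> s1 x; exact: map_unique_argmax.
move=> mu dT T P Z W nZ nW indep i.
(* Only the noises of coordinate [k] enter the error there. [emb] locates them in the full family,
   and its injectivity transfers pairwise independence. *)
pose N (k : 'I_d) (u : 'I_m + 'I_m * 'I_n) : {RV P >-> R} :=
  match u with inl i' => Z i' k | inr p => W p.1 p.2 k end.
pose emb (k : 'I_d) (u : 'I_m + 'I_m * 'I_n) : ('I_m * 'I_d) + ('I_m * 'I_n * 'I_d) :=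
  match u with inl i' => inl (i', k) | inr p => inr (p.1, p.2, k) end.
have embN k u : (N k u : T -> R) = noise_family (fun a b => (Z a b : T -> R))
    (fun a b c => (W a b c : T -> R)) (emb k u) by case: u => [|[]].
have emb_inj k : injective (emb k).
  by move=> [i1|[i1 j1]] [i2|[i2 j2]] //= [] => [->|-> ->].
have nN k u : std_normal P (N k u) by case: u => [i1|p]; [exact: nZ|exact: nW].
have errE k w : theta_hat s_th s_x
      (fun i' j k' => X_rv mu s_th s_x (fun a b => Z a b : T -> R)
        (fun a b c => W a b c : T -> R) i' j k' w) i k
    - theta_rv mu s_th (fun a b => Z a b : T -> R) i k w =
    \sum_u error_coef s_th s_x i u * N k u w.
  rewrite (error_lin_comb s_th s_x i m0 n0 mu k (fun a b => Z a b w)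
    (fun a b c => W a b c w)).
  by apply: eq_bigr => -[].
rewrite unlock; under eq_integral => w _.
  rewrite /sqnorm; under eq_bigr do rewrite errE.
  rewrite -sumEFin; over.
rewrite ge0_integral_sum//; last 2 first.
- move=> k; apply/measurable_EFinP/measurable_funX/measurable_sum => u.
  exact: measurable_funM.
- by move=> k w _; rewrite lee_fin sqr_ge0.
(* Every coordinate obeys the same bound, whence the factor [d]. *)
apply: (@le_trans _ _ (\sum_(k < d) (\sum_u error_coef s_th s_x i u ^+ 2)%:E)%E).
  apply: lee_sum => k _; apply: integral_sqr_lin_comb_le => [u|u v uv].
    exact: integral_sqr_std_normal_le1.
  apply: integral_std_normalM => // A B mA mB; rewrite !embN.
  by apply: mutually_independent_pair => //; rewrite (inj_eq (emb_inj k)).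
rewrite sumEFin lee_fin sumr_const card_ord sum_sqr_error_coef//.
by rewrite -(mulr_natl (_ * _)) !mulrA.
Qed.
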